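(* Let $d,n,m\ge 1$, let $s\in\mathbb{C}\otimes\mathbb{C}^d\otimes\mathbb{C}^d$ and $t\in\mathbb{C}^2\otimes\mathbb{C}^n\otimes\mathbb{C}^m$. Then $\mathrm{R}(t\boxtimes s)=\mathrm{R}(t\otimes s)=\mathrm{R}(t)\,\mathrm{R}(s)$.
   Context: The tensor rank $\mathrm{R}(t)$ of $t\in U_1\otimes\cdots\otimes U_k$ is the smallest $r$ such that $t$ is a sum of $r$ simple tensors $u_1\otimes\cdots\otimes u_k$. The tensor product of a $k$-tensor $t\in U_1\otimes\cdots\otimes U_k$ and an $\ell$-tensor $s\in V_1\otimes\cdots\otimes V_\ell$ is the $(k+\ell)$-tensor $t\otimes s\in U_1\otimes\cdots\otimes U_k\otimes V_1\otimes\cdots\otimes V_\ell$ (no factors grouped). If $k=\ell$, the tensor Kronecker product $t\boxtimes s\in(U_1\otimes V_1)\otimes\cdots\otimes(U_k\otimes V_k)$ is the $k$-tensor obtained from $t\otimes s$ by grouping $U_i$ and $V_i$ together for each $i$. *)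

(* Defs.v *)
From mathcomp Require Import all_boot all_order all_algebra.
From mathcomp Require Import boolp reals.
From mathcomp Require Export complex.

Set Implicit Arguments.
Unset Strict Implicit.
Unset Printing Implicit Defensive.

Import GRing.Theory.
Local Open Scope ring_scope.

Definition dim3 (a b c : nat) (i : 'I_3) : finType :=
  'I_(tnth [tuple a; b; c] i).

Definition sum_family (K L : finType) (T : K -> finType) (S : L -> finType)
    (i : K + L) : finType :=
  match i with inl k => T k | inr l => S l end.

Definition prod_family (K : finType) (T S : K -> finType) (k : K) : finType :=
  (T k * S k)%type.

Section Tensors.
Variable F : fieldType.

(* Tensors in the tensor product, over the modes k : K, of the coordinate
   spaces F^(T k), given by their coordinates in the product basis.  Letting
   the modes and the bases be arbitrary finite types means that
   F^A (x) F^B is F^(A * B), and that an ungrouped product of tensors with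
   modes K and L is a tensor with modes K + L. *)
Definition multi_index (K : finType) (T : K -> finType) :=
  {dffun forall k : K, T k}.

Definition tensor (K : finType) (T : K -> finType) :=
  {ffun multi_index T -> F}.

(* F^a (x) F^b (x) F^c *)
Definition tensor3 (a b c : nat) := tensor (dim3 a b c).

Definition simple_tensor (K : finType) (T : K -> finType)
    (u : forall k : K, {ffun T k -> F}) : tensor T :=
  [ffun I : multi_index T => \prod_(k : K) u k (I k)].

Definition sum_of_simple (K : finType) (T : K -> finType) (t : tensor T)
    (r : nat) : Prop :=
  exists u : 'I_r -> forall k : K, {ffun T k -> F},
    t = \sum_(j < r) simple_tensor (u j).

(* Junk value 0 when t is not a sum of simple tensors; this only happens for
   tensors without modes, see [sum_of_simple_ex]. *)
Definition tensor_rank (K : finType) (T : K -> finType) (t : tensor T) : nat :=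
  if pselect (exists r, `[< sum_of_simple t r >]) is left t_sum
  then ex_minn t_sum else 0%N.

Definition tensor_prod (K L : finType) (T : K -> finType) (S : L -> finType)
    (t : tensor T) (s : tensor S) : tensor (sum_family T S) :=
  [ffun I : multi_index _ =>
    t (finfun (fun k : K => I (inl k))) * s (finfun (fun l : L => I (inr l)))].

Definition kronecker_prod (K : finType) (T S : K -> finType)
    (t : tensor T) (s : tensor S) : tensor (prod_family T S) :=
  [ffun I : multi_index _ =>
    t (finfun (fun k => (I k).1)) * s (finfun (fun k => (I k).2))].

Lemma sum_of_simple_ex (K : finType) (T : K -> finType) (t : tensor T) :
  (0 < #|K|)%N -> exists r, sum_of_simple t r.
Proof.
case/card_gt0P => k0 _; exists #|{: multi_index T}|.
pose u (I : multi_index T) (k : K) : {ffun T k -> F} :=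
  [ffun x => (if k == k0 then t I else 1) * (x == I k)%:R].
exists (fun j => u (enum_val j)); apply/ffunP => J.
rewrite sum_ffunE -(big_enum_val (fun I => simple_tensor (u I) J)) /=.
rewrite (bigD1 J) //= big1 ?addr0 => [|I neqIJ].
  rewrite ffunE (eq_bigr (fun k => if k == k0 then t J else 1)).
    by rewrite -big_mkcond /= big_pred1_eq.
  by move=> k _; rewrite ffunE eqxx mulr1.
have [k neq_k] : exists k, J k != I k.
  apply/existsP; apply: contraNT neqIJ; rewrite negb_exists => /forallP eqIJ.
  by apply/eqP/ffunP => k; move/negPn/eqP: (eqIJ k).
by rewrite ffunE (bigD1 k) //= ffunE (negPf neq_k) mulr0 mul0r.
Qed.

Lemma tensor_rankP (K : finType) (T : K -> finType) (t : tensor T) :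
  (0 < #|K|)%N ->
  sum_of_simple t (tensor_rank t) /\
  (forall r, sum_of_simple t r -> (tensor_rank t <= r)%N).
Proof.
move=> K_gt0; rewrite /tensor_rank; case: pselect => [t_sum|[]]; last first.
  by have [r tr] := sum_of_simple_ex t K_gt0; exists r; apply/asboolP.
case: ex_minnP => r /asboolP tr r_min; split=> // r' tr'.
by apply: r_min; apply/asboolP.
Qed.

End Tensors.

(* Main.v *)
Require Import Defs.
From mathcomp Require Import all_boot all_order all_algebra.
From mathcomp Require Import boolp reals mxtens ring zify.

(** The two inequalities R(t [x] s) <= R(t (x) s) <= R(t) R(s) hold for all
tensors: regroup, or multiply, the simple summands. The point is the lower bound
R(t) R(s) <= R(t [x] s) for the grouped product.

Slicing t along its first mode gives a pencil of n x m matrices A, B, and s is a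
d x d matrix S; then t [x] s is the pencil formed by the Kronecker products of A
and B with S, which after a change of bases consists of r = rank S copies of the
pencil (A, B). So it suffices to know the rank of a pencil exactly, by a formula
that visibly multiplies by r when r copies are taken.

The formula is that of Grigoriev and Ja'Ja'. The usual one reads the rank off
the Kronecker canonical form. The following form of it avoids canonical forms. For
a point p of the projective line let N_p be the corresponding member of the
pencil (A at infinity, B - x A at x) and M_p another one. With matrices acting on
row vectors, the Jordan chains of length two at p start at the space
  W_p = { v | v N_p = 0 and v M_p lies in the row space of N_p }.
If no row vector is killed by both A and B, and their row spaces span everything,
the rank of the pencil is m + max_p dim W_p. Both m and dim W_p are multiplied by
r when r copies are taken ([pencil_decomp_tens]).

Lower bound ([pencil_decomp_lower]). A decomposition of length r is a compression
of a diagonal pencil on F^r, and diagonal pencils have no Jordan chains. So the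
chains of length two of the compressed pencil have to come from the kernel of the
compression, whose dimension is r - m.

Upper bound ([pencil_decomp_upper]). By induction on max_p dim W_p.
 - If all W_p vanish, then the column kernels of the N_p span F^m, and a basis of
   such kernel vectors is a decomposition of length m
   ([pencil_decomp_no_chain]). Otherwise some nonzero w lies in the row space of
   every N_p; writing w = v(x) N_x with a rational function v, a pole of v,
   possibly at infinity, produces a Jordan chain of length two
   ([no_chain_image]).
 - Otherwise, a well-chosen hyperplane of row vectors lowers every nonzero W_p at
   once ([cutting_functional]), and restricting the pencil to a hyperplane that
   misses some kernel vector of some N_p costs only one simple tensor
   ([pencil_decomp_hyperplane]). At all but finitely many points W_p is the whole
   kernel of N_p; the finitely many other points only ask for a generic
   hyperplane. If N_x has a kernel for all x, it contains a polynomial vector v(x)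
   without zeros, and it is enough that the functional phi defining the hyperplane
   gives a polynomial phi(v(x)) with simple roots, which exists by a Bertini
   argument ([simple_root_functional]). *)

Set Implicit Arguments.
Unset Strict Implicit.
Unset Printing Implicit Defensive.

Import GRing.Theory Num.Theory.
Local Open Scope ring_scope.

(** * Polynomial matrices *)

Notation polymx := (map_mx polyC).
Notation eval_mx x := (map_mx (horner_eval x)).

Definition pencilX (F : nzRingType) (n m : nat) (A B : 'M[F]_(n, m)) :
  'M[{poly F}]_(n, m) := polymx B - 'X *: polymx A.

Section PolynomialMatrices.
Variable F : numClosedFieldType.
Notation deriv_mx := (map_mx (@deriv F)).
Implicit Types (n m k : nat) (x : F) (g : {poly F}).

Lemma poly_nonroot g : g != 0 -> exists x, g.[x] != 0.
Proof.
move=> g0; case: (leqP (size g) 1) => [/size1_polyC gE|sg].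
  by exists 0; rewrite horner_coef0; apply: contraNneq g0 => g00; rewrite gE g00.
have /closed_rootP[x] : size (g - 1) != 1%N.
  by rewrite size_polyDl ?size_polyN ?size_poly1 // neq_ltn sg orbT.
rewrite /root hornerD hornerN hornerC subr_eq0 => /eqP gx.
by exists x; rewrite gx oner_eq0.
Qed.

Lemma eval_polymx n m x (M : 'M[F]_(n, m)) : eval_mx x (polymx M) = M.
Proof. by apply/matrixP => i j; rewrite !mxE /horner_eval hornerC. Qed.

Lemma eval_pencilX n m x (A B : 'M[F]_(n, m)) :
  eval_mx x (pencilX A B) = B - x *: A.
Proof.
by apply/matrixP => i j; rewrite !mxE /horner_eval !hornerE.
Qed.

Lemma eval_scale n m x g (M : 'M[{poly F}]_(n, m)) :
  eval_mx x (g *: M) = g.[x] *: eval_mx x M.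
Proof. by apply/matrixP => i j; rewrite !mxE /horner_eval hornerM. Qed.

Lemma eval_inj n m g (M N : 'M[{poly F}]_(n, m)) : g != 0 ->
  (forall x, g.[x] != 0 -> eval_mx x M = eval_mx x N) -> M = N.
Proof.
move=> g0 MN; apply/matrixP => i j; apply/eqP; rewrite -subr_eq0.
apply/negPn/negP => d0.
have /poly_nonroot[x] : (M i j - N i j) * g != 0 by rewrite mulf_neq0.
rewrite hornerM mulf_eq0 negb_or => /andP[dx /MN/matrixP/(_ i j)].
rewrite !mxE /horner_eval => MNx.
by rewrite hornerD hornerN MNx subrr eqxx in dx.
Qed.

Lemma deriv_mulmx n m k (M : 'M[{poly F}]_(n, m)) (N : 'M_(m, k)) :
  deriv_mx (M *m N) = deriv_mx M *m N + M *m deriv_mx N.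
Proof.
apply/matrixP => i j; rewrite !mxE raddf_sum -big_split /=.
by apply: eq_bigr => l _; rewrite !mxE derivM.
Qed.

Lemma deriv_polymx n m (M : 'M[F]_(n, m)) : deriv_mx (polymx M) = 0.
Proof. by apply/matrixP => i j; rewrite !mxE derivC. Qed.

Lemma deriv_pencilX n m (A B : 'M[F]_(n, m)) :
  deriv_mx (pencilX A B) = - polymx A.
Proof.
by apply/matrixP => i j; rewrite !mxE !derivE; ring.
Qed.

Lemma deriv_scale n m g (M : 'M[{poly F}]_(n, m)) :
  deriv_mx (g *: M) = g^`() *: M + g *: deriv_mx M.
Proof. by apply/matrixP => i j; rewrite !mxE derivM. Qed.

Lemma scale_polymx_inj n m g : g != 0 ->
  injective (fun M : 'M[{poly F}]_(n, m) => g *: M).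
Proof.
move=> g0 M N /matrixP MN; apply/matrixP => i j; apply: (mulfI g0).
by have := MN i j; rewrite !mxE.
Qed.

Lemma eval0_factor n (v : 'rV[{poly F}]_n) x : eval_mx x v = 0 ->
  v = ('X - x%:P) *: map_mx (fun p => p %/ ('X - x%:P)) v.
Proof.
move=> v0; apply/rowP => j; rewrite !mxE mulrC divpK // dvdp_XsubCl.
by have /rowP/(_ j)/eqP := v0; rewrite !mxE.
Qed.

(** A vector of least degree in the kernel is nowhere zero, as otherwise a linear
factor could be divided out. *)
Lemma nowhere_zero_kernel n m (M : 'M[{poly F}]_(n, m)) (v : 'rV_n) :
  v != 0 -> v *m M = 0 ->
  exists2 u : 'rV_n, u *m M = 0 & forall x, eval_mx x u != 0.
Proof.
have [k] : exists k, forall j, (size (v ord0 j) <= k)%N.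
  exists (\max_j size (v ord0 j)) => j.
  exact: (leq_bigmax (F := fun j => size (v ord0 j))).
elim: k v => [|k IH] v szv v0 vM.
  case/eqP: v0; apply/rowP => j; rewrite mxE; apply/eqP.
  by rewrite -size_poly_leq0 szv.
have [[x /eqP vx]|nox] := pselect (exists x, eval_mx x v == 0); last first.
  by exists v => // x; apply/negP => vx; apply: nox; exists x.
have vE := eval0_factor vx; set u := map_mx _ v in vE.
have X0 : 'X - x%:P != 0 :> {poly F} by rewrite polyXsubC_eq0.
apply: (IH u) => [j||].
- rewrite mxE size_divp // size_XsubC leq_subLR add1n; exact: szv.
- by apply: contraNneq v0 => u0; rewrite vE u0 scaler0.
- by apply: (scale_polymx_inj X0); rewrite scaler0 scalemxAl -vE.
Qed.

(** Each of the conditions fails for at most one value of [s]. *)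
Lemma affine_avoid (ps : seq (F * F)) : all (fun p => p != (0, 0)) ps ->
  exists s, all (fun p => p.1 + s * p.2 != 0) ps.
Proof.
move=> ps0; pose g := \prod_(p <- ps) (p.1%:P + p.2 *: 'X).
have /poly_nonroot[s] : g != 0.
  rewrite prodf_seq_neq0; apply: sub_all ps0 => -[a b] /= ab0.
  apply: contraNneq ab0 => /polyP E.
  have := E 0%N; have := E 1%N; rewrite !coefE /= mulr0 addr0 mulr1 add0r.
  by move=> -> ->.
rewrite horner_prod prodf_seq_neq0 => gs; exists s.
by apply: sub_all gs => -[a b] /=; rewrite !hornerE mulrC.
Qed.

(** The moment vector (1, x, x^2, ...) works for all but finitely many x. *)
Lemma generic_functional n (ws : seq 'rV[F]_n) : 0 \notin ws ->
  exists phi : 'cV[F]_n, {in ws, forall w, w *m phi != 0}.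
Proof.
move=> ws0; have /poly_nonroot[x] : \prod_(w <- ws) rVpoly w != 0.
  rewrite prodf_seq_neq0; apply/allP => w ww /=.
  by apply: contraNneq ws0 => w0; rewrite -(rVpolyK w) w0 linear0 in ww *.
rewrite horner_prod prodf_seq_neq0 => /allP wx.
exists (\col_j x ^+ j) => w /wx /=; apply: contraNneq.
move/matrixP/(_ 0 0); rewrite !mxE horner_poly => wphi; apply/eqP.
by rewrite -[RHS]wphi; apply: eq_bigr => j _; rewrite !mxE valK.
Qed.

(** If the Wronskian vanishes then f divides f' and hence, in characteristic 0, is
constant. *)
Lemma wronskian_eq0 (f g : {poly F}) : coprimep f g ->
  f^`() * g = f * g^`() -> (size f <= 1)%N.
Proof.
have [->|f0 fg E] := eqVneq f 0; first by rewrite size_poly0.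
have f'0 : f^`() = 0.
  apply: contraTeq (lt_size_deriv f0) => f'0; rewrite -leqNgt.
  apply: dvdp_leq => //; rewrite -(Gauss_dvdpl _ fg) E dvdp_mulr //.
apply/leq_sizeP => -[|i] // _.
have /polyP/(_ i) := f'0; rewrite coef_deriv coef0 => /eqP.
by rewrite mulrn_eq0 => /eqP.
Qed.

(** Bertini: a linear system of polynomials without base point has a member all
of whose roots are simple. Here the system consists of the [v *m phi]; pick two
coprime members f1 and f2. A multiple root of f1 + s f2 is a root of their
Wronskian, and each of these finitely many points is a root for at most one s. The
nonvanishing on [ws] excludes finitely many further values of s. *)
Lemma simple_root_functional n (v : 'rV[{poly F}]_n) (ws : seq 'rV[F]_n) :
    0 \notin ws -> (forall x, eval_mx x v != 0) ->
  exists2 phi : 'cV[F]_n, {in ws, forall w, w *m phi != 0} &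
    forall x, eval_mx x v *m phi = 0 -> eval_mx x (deriv_mx v) *m phi != 0.
Proof.
move=> ws0 vn0.
pose ft (phi : 'cV[F]_n) : {poly F} := (v *m polymx phi) 0 0.
have ftE phi x : eval_mx x v *m phi = (ft phi).[x]%:M.
  by rewrite [LHS]mx11_scalar -[in LHS](eval_polymx x phi) -map_mxM mxE.
have dftE phi x : eval_mx x (deriv_mx v) *m phi = (ft phi)^`().[x]%:M.
  rewrite [LHS]mx11_scalar -[in LHS](eval_polymx x phi) -map_mxM.
  have := deriv_mulmx v (polymx phi); rewrite deriv_polymx mulmx0 addr0 => <-.
  by congr _%:M; rewrite mxE mxE.
have [phi1 phi1P] : exists phi1 : 'cV[F]_n,
    {in [:: eval_mx 0 v], forall w, w *m phi1 != 0}.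
  by apply: generic_functional; rewrite inE eq_sym vn0.
pose f1 := ft phi1; have f10 : f1 != 0.
  have := phi1P _ (mem_head _ _); rewrite ftE -/f1; apply: contraNneq => ->.
  by rewrite horner0 raddf0.
have [rs f1rs] := closed_field_poly_normal f1.
have root1 x : root f1 x -> x \in rs.
  by rewrite f1rs rootZ ?lead_coef_eq0 // root_prod_XsubC.
have [phi2 phi2P] : exists phi2 : 'cV[F]_n,
    {in ws ++ [seq eval_mx x v | x <- rs], forall w, w *m phi2 != 0}.
  apply: generic_functional; rewrite mem_cat negb_or ws0.
  by apply/mapP => -[x _ E]; move: (vn0 x); rewrite -E eqxx.
pose f2 := ft phi2.
have cop : coprimep f1 f2.
  apply/Pdiv.ClosedField.coprimepP => x /root1 xrs.
  have : eval_mx x v *m phi2 != 0.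
    by apply: phi2P; rewrite mem_cat (map_f (fun z => eval_mx z v)) ?orbT.
  by rewrite ftE; apply: contraNneq => ->; rewrite raddf0.
pose W := f1^`() * f2 - f1 * f2^`().
have [zs Wzs] := closed_field_poly_normal W.
have f12 x : (f1.[x], f2.[x]) != (0, 0).
  apply/eqP => -[f1x f2x].
  by have := coprimep_root cop (introT eqP f1x); rewrite f2x eqxx.
(* the value at 0 serves the case where the Wronskian vanishes *)
pose ps := (f1.[0], f2.[0]) :: [seq (f1.[x], f2.[x]) | x <- zs] ++
   [seq ((w *m phi1) 0 0, (w *m phi2) 0 0) | w <- ws].
have [|s /allP sP] := @affine_avoid ps.
  rewrite /= f12 /= all_cat !all_map.
  apply/andP; split; apply/allP; first by move=> x _; exact: f12.
  move=> w ww /=; have : w *m phi2 != 0 by apply: phi2P; rewrite mem_cat ww.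
  by apply: contraNneq => -[_ E]; rewrite [w *m _]mx11_scalar E raddf0.
have phiE : ft (phi1 + s *: phi2) = f1 + s *: f2.
  rewrite /ft map_mxD mulmxDr mxE; congr (_ + _).
  by rewrite map_mxZ -scalemxAr mxE mul_polyC.
exists (phi1 + s *: phi2) => [w ww|x].
  have /sP : ((w *m phi1) 0 0, (w *m phi2) 0 0) \in ps.
    by rewrite inE mem_cat (map_f (fun w => (_, _))) // !orbT.
  apply: contraNneq => /matrixP/(_ 0 0).
  by rewrite mulmxDr -scalemxAr !mxE => ->.
rewrite ftE dftE phiE => /matrixP/(_ 0 0).
rewrite !mxE mulr1n derivD derivZ !hornerE => fx.
apply/negP => /eqP/matrixP/(_ 0 0); rewrite !mxE mulr1n => f'x.
have Wx : W.[x] = 0.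
  rewrite /W !hornerE.
  have -> : f1.[x] = - (s * f2.[x]) by apply/eqP; rewrite -addr_eq0 fx.
  have -> : f1^`().[x] = - (s * f2^`().[x]) by apply/eqP; rewrite -addr_eq0 f'x.
  by ring.
have [W0|W0] := eqVneq W 0.
  (* f1 and f2 are then constant, so no root at 0 means no root at all *)
  have W1 : f1^`() * f2 = f1 * f2^`() by apply/eqP; rewrite -subr_eq0 -/W W0.
  have f1C := size1_polyC (wronskian_eq0 cop W1).
  have f2C : f2 = (f2`_0)%:P.
    apply/size1_polyC/(@wronskian_eq0 f2 f1); first by rewrite coprimep_sym.
    by rewrite mulrC -W1 mulrC.
  have /eqP[] := sP _ (mem_head _ _).
  by move: fx; rewrite f1C f2C !hornerC.
have /sP/eqP[] : (f1.[x], f2.[x]) \in ps.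
  rewrite inE mem_cat (map_f (fun x => (_, _))) ?orbT //.
  rewrite -root_prod_XsubC -(rootZ _ _ (a := lead_coef W)) ?lead_coef_eq0 //.
  by rewrite -Wzs; apply/eqP.
exact: fx.
Qed.
End PolynomialMatrices.

(** * Jordan chains of a pencil *)

Section Chains.
Variable F : fieldType.
Implicit Types (n m k : nat).

(** The starting vectors v of the Jordan chains of length two of the pencil spanned
by [N] and [M], at its member [N]: v N = 0 and v M = u N for some u. *)
Definition chains n m (N M : 'M[F]_(n, m)) : 'M_n :=
  kermx (row_mx N (M *m cokermx N)).

Lemma sub_chains n m k (N M : 'M[F]_(n, m)) (W : 'M_(k, n)) :
  (W <= chains N M)%MS = (W *m N == 0) && (W *m M <= N)%MS.
Proof.
by rewrite sub_kermx mul_mx_row row_mx_eq0 submxE mulmxA.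
Qed.

Lemma chains_restrict n m k (N M : 'M[F]_(n, m)) (J : 'M_(k, n)) :
  (chains (J *m N) (J *m M) *m J <= chains N M)%MS.
Proof.
have := submx_refl (chains (J *m N) (J *m M)); rewrite sub_chains => /andP[].
rewrite !mulmxA => WN WM; rewrite sub_chains WN.
exact: submx_trans WM (submxMl _ _).
Qed.

End Chains.

Section GenericPencil.
Variable F : numClosedFieldType.
Implicit Types (n m k : nat) (x : F).

(** A generalized inverse of the generic member of the pencil. Take x0 where the
rank r of the members is largest and choose [L], [G] so that L (B - x0 A) G = 1.
At every x with det D(x) <> 0 the member B - x A then has rank exactly r and has
the same row space as L (B - x A), which gives the identity at x. *)
Lemma generic_factor n m (A B : 'M[F]_(n, m)) :
  exists r (L : 'M[F]_(r, n)) (G : 'M[F]_(m, r)),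
    let NX := pencilX A B in let D := polymx L *m NX *m polymx G in
    \det D != 0 /\
    \det D *: NX = NX *m polymx G *m \adj D *m polymx L *m NX.
Proof.
pose P k := `[< exists x, \rank (B - x *: A) = k >].
have Pex : exists k, P k by exists (\rank (B - 0 *: A)); apply/asboolP; exists 0.
have Pub k : P k -> (k <= n)%N by move=> /asboolP[x <-]; apply: rank_leq_row.
case: (ex_maxnP Pex Pub) => r /asboolP[x0 x0r] rmax; pose N0 := B - x0 *: A.
have [L LN] := row_fullP (col_base_full N0).
have [G NG] := row_freeP (row_base_free N0).
rewrite -/N0 in x0r; case: _ / x0r L G LN NG rmax {Pub Pex} => L G LN NG rmax.
exists (\rank N0), L, G => NX D.
have evD x : eval_mx x D = L *m (B - x *: A) *m G.
  by rewrite !map_mxM !eval_polymx eval_pencilX.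
have evdet x : (\det D).[x] = \det (L *m (B - x *: A) *m G).
  by rewrite -evD det_map_mx.
have D0 : \det D != 0.
  have : (\det D).[x0] != 0.
    rewrite evdet -/N0 (_ : L *m N0 *m G = 1%:M) ?det1 ?oner_eq0 //.
    transitivity (L *m (col_base N0 *m row_base N0) *m G).
      by rewrite mulmx_base.
    by rewrite mulmxA LN mul1mx NG.
  by apply: contraNneq => ->; rewrite horner0.
split=> //; apply: (eval_inj D0) => x Dx.
rewrite eval_scale !map_mxM map_mx_adj evD !eval_polymx eval_pencilX evdet.
rewrite evdet in Dx; set N := B - x *: A in Dx *.
have /submxP[E NE] : (N <= L *m N)%MS.
  rewrite -(mxrank_leqif_sup (submxMl L N)).2 eqn_leq mxrankM_maxr /=.
  apply: leq_trans (rmax _ _) _; first by apply/asboolP; exists x.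
  apply: leq_trans (mxrankM_maxl (L *m N) G).
  by rewrite mxrank_unit // unitmxE unitfE.
set T := L *m N in NE Dx *.
have -> : N *m G = E *m (T *m G) by rewrite {1}NE mulmxA.
move: (T *m G) => D1; rewrite -!mulmxA -/T (mulmxA D1) mul_mx_adj.
by rewrite mul_scalar_mx -scalemxAr -NE.
Qed.

(** Where the rank of the pencil is locally constant, a kernel vector extends to a
chain. Multiply the identity of [generic_factor] on the left by a kernel matrix K of
B - x A: as K (B - X A) = (x - X) K A, the factor x - X cancels. *)
Lemma chains_generic n m (A B : 'M[F]_(n, m)) :
  exists2 g : {poly F}, g != 0 &
    forall x, g.[x] != 0 ->
      (kermx (B - x *: A) <= chains (B - x *: A) A)%MS.
Proof.
have [r [L [G [D0 DE]]]] := generic_factor A B.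
set D := polymx L *m _ *m _ in D0 DE; exists (\det D) => // x Dx.
rewrite sub_chains mulmx_ker eqxx /=; set K := kermx _.
have KX : polymx K *m pencilX A B = (x%:P - 'X) *: polymx (K *m A).
  have KB : K *m B = x *: (K *m A).
    apply/eqP; rewrite -subr_eq0 scalemxAr -mulmxBr.
    by rewrite mulmx_ker.
  rewrite mulmxBr -scalemxAr -!map_mxM KB.
  move: (K *m A) => Y; apply/matrixP => i j.
  by rewrite !mxE mulrBl -polyCM.
have X0 : x%:P - 'X != 0 :> {poly F}.
  by rewrite -opprB oppr_eq0 polyXsubC_eq0.
have {}DE : \det D *: polymx (K *m A) =
    polymx (K *m A) *m polymx G *m \adj D *m polymx L *m pencilX A B.
  apply: (scale_polymx_inj X0).
  rewrite scalerA mulrC -scalerA -KX scalemxAr DE !mulmxA KX.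
  by rewrite !scalemxAl.
have := congr1 (map_mx (horner_eval x)) DE.
rewrite eval_scale (map_mxM (horner_eval x)) eval_pencilX eval_polymx => E.
by rewrite -[K *m A](scalerK Dx) scalemx_sub // E submxMl.
Qed.

(** In the second case the rank r of [generic_factor] is less than n, and for a row
vector l outside the row space of [L] the defect of the generalized inverse at l
is a nonzero polynomial vector in the kernel. *)
Lemma generic_kernel n m (A B : 'M[F]_(n, m)) :
  (exists2 g : {poly F}, g != 0 &
     forall x, g.[x] != 0 -> row_free (B - x *: A)) \/
  (exists2 v : 'rV_n, v *m pencilX A B = 0 & forall x, eval_mx x v != 0).
Proof.
have [r [L [G [D0 DE]]]] := generic_factor A B.
set D := polymx L *m _ *m _ in D0 DE.
have evD x : eval_mx x D = L *m (B - x *: A) *m G.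
  by rewrite !map_mxM !eval_polymx eval_pencilX.
have [nr|rn] := leqP n r.
  left; exists (\det D) => // x Dx; rewrite -row_leq_rank.
  apply: leq_trans (mxrankM_maxr L _); apply: leq_trans (mxrankM_maxl _ G).
  by rewrite -evD mxrank_unit // unitmxE unitfE det_map_mx.
have [x Dx] := poly_nonroot D0; right; have /row_subPn[i iL] : ~~ (1%:M <= L)%MS.
  by rewrite sub1mx /row_full neq_ltn (leq_ltn_trans (rank_leq_row L) rn).
move: (row i _) iL => l lL.
pose v := \det D *: polymx l -
  polymx l *m pencilX A B *m polymx G *m \adj D *m polymx L.
apply: (@nowhere_zero_kernel _ _ _ _ v).
  apply: contraNneq lL => /(congr1 (map_mx (horner_eval x))).
  rewrite map_mx0 map_mxB eval_scale !(map_mxM (horner_eval x)) !eval_polymx.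
  move/eqP; rewrite subr_eq0 => /eqP E.
  by rewrite -[l](scalerK Dx) scalemx_sub // E submxMl.
by rewrite /v mulmxBl -scalemxAl scalemxAr DE !mulmxA subrr.
Qed.

(** Write w = v_x (B - x A). Applying v_x to the identity of [generic_factor] at x
eliminates v_x, which need not be polynomial in x. *)
Lemma everywhere_in_image n m (A B : 'M[F]_(n, m)) (w : 'rV_m) :
    (forall x, (w <= B - x *: A)%MS) ->
  exists (d : {poly F}) (q : 'rV_n),
    d != 0 /\ d *: polymx w = q *m pencilX A B.
Proof.
move=> wN; have [r [L [G [D0 DE]]]] := generic_factor A B.
set D := polymx L *m _ *m _ in D0 DE.
exists (\det D), (polymx w *m polymx G *m \adj D *m polymx L); split=> //.
apply: (eval_inj D0) => x _; have /submxP[v wv] := wN x.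
have := congr1 (map_mx (horner_eval x)) DE.
rewrite !(map_mxM (horner_eval x)) !eval_scale !eval_polymx eval_pencilX => E.
by rewrite wv scalemxAr E !mulmxA.
Qed.

End GenericPencil.

(** * Pencils without Jordan chains *)

(** The columns of [P] and the rows of [Q] are the factors of the [r] simple
summands in the last two modes, the columns of [a] and [b] those in the first. *)
Definition pencil_decomp (F : fieldType) n m (A B : 'M[F]_(n, m)) r :=
  exists (P : 'M[F]_(n, r)) (Q : 'M[F]_(r, m)) (a b : 'rV[F]_r),
    A = P *m diag_mx a *m Q /\ B = P *m diag_mx b *m Q.

Section NoChain.
Variables (F : numClosedFieldType) (n m : nat) (A B : 'M[F]_(n, m)).
Hypothesis chains0 : forall x, chains (B - x *: A) A = 0.
Hypothesis chains_oo0 : chains A B = 0.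

(** By [everywhere_in_image], w = q(x) (B - x A) / d(x). Let x be a root of d.
Then q(x) is in the kernel of B - x A and, by derivation, q(x) A is in its row space,
as w is. So q(x) = 0 and the factor X - x cancels. *)
Lemma no_chain_clear_denominator (w : 'rV_m) :
    (forall x, (w <= B - x *: A)%MS) ->
  exists c (q : 'rV_n), c != 0 /\ polymx (c *: w) = q *m pencilX A B.
Proof.
move=> wN; have [d [q [d0 dq]]] := everywhere_in_image wN.
have [k] := ubnP (size d); elim: k d q d0 dq => // k IH d q d0 dq szd.
have [sd1|/closed_rootP[x dx]] := eqVneq (size d) 1%N.
  have dE := size1_polyC (eq_leq sd1); exists d`_0, q; rewrite -dq dE coefC eqxx.
  split; first by move: d0; rewrite {1}dE polyC_eq0.
  by apply/matrixP => i j; rewrite !mxE polyCM.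
have qx : eval_mx x q = 0.
  apply/eqP; rewrite -submx0 -(chains0 x) sub_chains.
  have := congr1 (map_mx (horner_eval x)) dq.
  rewrite eval_scale (map_mxM (horner_eval x)) eval_pencilX (rootP dx).
  rewrite scale0r => <-.
  rewrite eqxx /=.
  have := congr1 (fun M => map_mx (horner_eval x) (map_mx (@deriv F) M)) dq.
  rewrite /= deriv_scale deriv_mulmx deriv_polymx deriv_pencilX.
  rewrite scaler0 addr0 eval_scale eval_polymx mulmxN map_mxB.
  rewrite !(map_mxM (horner_eval x)) eval_pencilX eval_polymx => /eqP.
  rewrite eq_sym subr_eq [eqbRHS]addrC -subr_eq => /eqP <-.
  by rewrite addmx_sub ?submxMl // eqmx_opp scalemx_sub.
have qE := eval0_factor qx; have X0 : 'X - x%:P != 0 by rewrite polyXsubC_eq0.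
have /factor_theorem[e dE] := dx; rewrite dE in d0 szd dq.
have e0 : e != 0 by apply: contraNneq d0 => ->; rewrite mul0r.
apply: (IH e _ e0); last first.
  by rewrite size_Mmonic ?monicXsubC // size_XsubC addn2 ltnS in szd.
by apply: (scale_polymx_inj X0); rewrite scalerA mulrC dq {1}qE scalemxAl.
Qed.

(** With constant denominator, the coefficients of q satisfy q_(j+1) B = q_j A and
q_0 B = c w. If q_(j+1) = 0 then q_j starts a chain at infinity, hence vanishes: so
all q_j do, going down from the degree. *)
Lemma no_chain_image (w : 'rV_m) :
  (forall x, (w <= B - x *: A)%MS) -> (w <= A)%MS -> w = 0.
Proof.
move=> /no_chain_clear_denominator[c [q [c0 qE]]] wA.
pose cf j := map_mx (coefp j) q.
have cfM j k (M : 'M_(n, k)) : map_mx (coefp j) (q *m polymx M) = cf j *m M.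
  apply/matrixP => i l; rewrite !mxE /= coef_sum.
  by apply: eq_bigr => h _; rewrite !mxE /= coefMC.
rewrite mulmxBr -scalemxAr in qE.
have cfX0 k (M : 'M_(1, k)) : map_mx (coefp 0) ('X *: M) = 0.
  by apply/matrixP => i l; rewrite !mxE /= coefXM.
have cfXS j k (M : 'M_(1, k)) :
    map_mx (coefp j.+1) ('X *: M) = map_mx (coefp j) M.
  by apply/matrixP => i l; rewrite !mxE /= coefXM.
have cfB0 : cf 0 *m B = c *: w.
  have := congr1 (map_mx (coefp 0)) qE; rewrite map_mxB cfX0 subr0 cfM => <-.
  by apply/matrixP => i l; rewrite !mxE /= coefC.
have cfBS j : cf j.+1 *m B = cf j *m A.
  have := congr1 (map_mx (coefp j.+1)) qE; rewrite map_mxB cfXS !cfM => /eqP.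
  rewrite eq_sym subr_eq => /eqP ->; rewrite (_ : map_mx _ _ = 0) ?add0r //.
  by apply/matrixP => i l; rewrite !mxE /= coefC.
have cf_chain j : cf j *m A = 0 -> cf j = 0.
  move=> jA; apply/eqP; rewrite -submx0 -chains_oo0 sub_chains jA eqxx /=.
  by case: j jA => [|j] _; rewrite ?cfBS ?submxMl // cfB0 scalemx_sub.
have [k qk] : exists k, forall j, (k <= j)%N -> cf j = 0.
  exists (\max_i size (q ord0 i)) => j kj; apply/rowP => i; rewrite !mxE /=.
  apply: nth_default; apply: leq_trans kj.
  exact: (leq_bigmax (F := fun i => size (q ord0 i))).
have cf0 : cf 0 = 0.
  elim: k qk => [|k IH] qk; first exact: qk.
  apply: IH => j; rewrite leq_eqVlt => /predU1P[<-|]; last exact: qk.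
  by apply: cf_chain; rewrite -cfBS qk ?mul0mx.
apply/eqP; move/eqP: cfB0; rewrite cf0 mul0mx eq_sym scalemx_eq0.
by rewrite (negPf c0).
Qed.
End NoChain.

(** The points of the projective line are the elements of [option F], with [None]
the point at infinity. *)
Section Points.
Variable F : fieldType.
Implicit Types (n m : nat) (p : option F).

Definition at_point n m (A B : 'M[F]_(n, m)) p :=
  if p is Some x then B - x *: A else A.

Definition off_point n m (A B : 'M[F]_(n, m)) p :=
  if p is Some _ then A else B.

Definition point_chains n m (A B : 'M[F]_(n, m)) p :=
  chains (at_point A B p) (off_point A B p).

Lemma point_span p : exists a b a' b' : F, forall n m (A B : 'M_(n, m)),
  A = a *: off_point A B p + a' *: at_point A B p /\
  B = b *: off_point A B p + b' *: at_point A B p.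
Proof.
case: p => [x|]; [exists 1, x, 0, 1 | exists 0, 1, 1, 0] => n m A B /=.
  by rewrite !scale1r scale0r addr0 addrC subrK.
by rewrite !scale1r !scale0r addr0 add0r.
Qed.

Lemma at_point_mull n m k p (A B : 'M_(n, m)) (J : 'M_(k, n)) :
  at_point (J *m A) (J *m B) p = J *m at_point A B p.
Proof. by case: p => //= x; rewrite mulmxBr scalemxAr. Qed.

Lemma off_point_mull n m k p (A B : 'M_(n, m)) (J : 'M_(k, n)) :
  off_point (J *m A) (J *m B) p = J *m off_point A B p.
Proof. by case: p. Qed.

Lemma diag_scalar_mx (c : F) : diag_mx c%:M = c%:M :> 'M_1.
Proof. by apply/matrixP => i j; rewrite !ord1 !mxE. Qed.

Lemma pencil_decomp_add1 n m (A B : 'M[F]_(n, m)) r (u : 'cV_n) (v : 'rV_m) a b :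
  pencil_decomp A B r ->
  pencil_decomp (A + a *: (u *m v)) (B + b *: (u *m v)) (r + 1).
Proof.
move=> [P [Q [al [be [-> ->]]]]].
exists (row_mx P u), (col_mx Q v), (row_mx al a%:M), (row_mx be b%:M).
by split; rewrite diag_mx_row mul_row_block mul_row_col !mulmx0 addr0 add0r;
  rewrite diag_scalar_mx mul_mx_scalar scalemxAl.
Qed.

Lemma pencil_decomp_pad n m (A B : 'M[F]_(n, m)) r s :
  pencil_decomp A B r -> (r <= s)%N -> pencil_decomp A B s.
Proof.
move=> AB /subnK <-; rewrite addnC.
elim: (s - r)%N => [|k IH]; first by rewrite addn0.
have := pencil_decomp_add1 0 0 0 0 IH.
by rewrite !scale0r !addr0 addn1 addnS.
Qed.

End Points.

(** As long as the kernel columns found so far do not span, some nonzero row w kills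
them all; by [no_chain_image] some member of the pencil does not have w in its
row space, so it has a kernel column that w does not kill. The matrix [G] is a
left inverse of the matrix [X] of the columns found. *)
Lemma pencil_decomp_no_chain (F : numClosedFieldType) n m (A B : 'M[F]_(n, m)) :
  (forall p, point_chains A B p = 0) -> pencil_decomp A B m.
Proof.
move=> AB0.
have step k : (k <= m)%N ->
    exists (X : 'M_(m, k)) (G : 'M_(k, m)) (P : 'M_(n, k)) (a b : 'rV_k),
    [/\ G *m X = 1%:M, A *m X = P *m diag_mx a & B *m X = P *m diag_mx b].
  elim: k => [_|k IH km].
    by exists 0, 0, 0, 0, 0; split; apply/matrixP => i [].
  have [X [G [P [a [b [GX AX BX]]]]]] := IH (ltnW km).
  pose w := nz_row (kermx X).
  have wX : w *m X = 0 by apply/sub_kermxP; apply: nz_row_sub.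
  have w0 : w != 0.
    rewrite nz_row_eq0 -mxrank_eq0 mxrank_ker subn_eq0 -ltnNge.
    exact: leq_ltn_trans (rank_leq_col X) km.
  have [p wp] : exists p, ~~ (w <= at_point A B p)%MS.
    apply/not_existsP => wN; case/eqP: w0; apply: (@no_chain_image _ _ _ A B).
    - by move=> x; apply: (AB0 (Some x)).
    - exact: (AB0 None).
    - by move=> x; apply/negPn/negP; apply: (wN (Some x)).
    - by apply/negPn/negP; apply: (wN None).
  have [j wj] : exists j, (w *m cokermx (at_point A B p)) 0 j != 0.
    by rewrite submxE in wp; have /rV0Pn := wp.
  pose xi := col j (cokermx (at_point A B p)).
  have pxi : at_point A B p *m xi = 0.
    by rewrite /xi colE mulmxA mulmx_coker mul0mx.
  set c := (w *m _) 0 j in wj.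
  have wxi : w *m xi = c%:M by rewrite [LHS]mx11_scalar /xi colE mulmxA -colE mxE.
  have [al [be [al' [be' /(_ _ _ A B)[AE BE]]]]] := point_span p.
  rewrite -addn1.
  exists (row_mx X xi), (col_mx (G *m (1%:M - c^-1 *: (xi *m w))) (c^-1 *: w)).
  exists (row_mx P (off_point A B p *m xi)), (row_mx a al%:M), (row_mx b be%:M).
  split.
  - rewrite mul_col_row scalar_mx_block; congr block_mx.
    + by rewrite -mulmxA mulmxBl mul1mx -scalemxAl -mulmxA wX mulmx0 scaler0 subr0.
    + rewrite -mulmxA mulmxBl mul1mx -scalemxAl -mulmxA wxi mul_mx_scalar.
      by rewrite scalerA mulVf // scale1r subrr mulmx0.
    + by rewrite -scalemxAl wX scaler0.
    + by rewrite -scalemxAl wxi scale_scalar_mx mulVf.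
  - rewrite diag_mx_row mul_mx_row mul_row_block !mulmx0 addr0 add0r -AX.
    by rewrite diag_scalar_mx mul_mx_scalar {2}AE mulmxDl -!scalemxAl pxi scaler0 addr0.
  - rewrite diag_mx_row mul_mx_row mul_row_block !mulmx0 addr0 add0r -BX.
    by rewrite diag_scalar_mx mul_mx_scalar {2}BE mulmxDl -!scalemxAl pxi scaler0 addr0.
have [X [G [P [a [b [/mulmx1C XG AX BX]]]]]] := step m (leqnn m).
by exists P, G, a, b; rewrite -AX -BX -!mulmxA XG !mulmx1.
Qed.

(** * Restriction to a hyperplane *)

Section Hyperplane.
Variables (F : numClosedFieldType) (n m : nat) (A B : 'M[F]_(n, m)).
Implicit Types (p : option F) (phi : 'cV[F]_n).

(** Restricting the row vectors to the kernel of [phi], or to rows [J] in it, loses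
a chain at [p]. *)
Definition cuts phi p := forall k (J : 'M[F]_(k, n)), J *m phi = 0 ->
  ~~ (point_chains A B p <= point_chains (J *m A) (J *m B) p *m J)%MS.

Lemma cuts_nz phi p : nz_row (point_chains A B p) *m phi != 0 -> cuts phi p.
Proof.
move=> wphi k J Jphi; apply: contra wphi => /(submx_trans (nz_row_sub _)).
by case/submxP => D ->; rewrite -!mulmxA Jphi !mulmx0.
Qed.

(** At a point where all kernel vectors start chains. If phi lost no chain at x,
it would kill the kernel of B - x A, hence v(x), and v(x) A = u (B - x A) for some u
with phi(u) = 0. But v(x) A = v'(x) (B - x A) by derivation, so v'(x) - u is in
the kernel and phi(v'(x)) = 0: then x would be a double root of phi(v). *)
Lemma cuts_generic (v : 'rV_n) phi x : v *m pencilX A B = 0 ->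
    (kermx (B - x *: A) <= chains (B - x *: A) A)%MS ->
    (eval_mx x v *m phi = 0 -> eval_mx x (map_mx (@deriv F) v) *m phi != 0) ->
  cuts phi (Some x).
Proof.
move=> vN Kx vphi k J Jphi; apply/negP => cJ.
have in_ker (u : 'rV_n) : u *m (B - x *: A) = 0 -> u *m phi = 0 /\
    exists2 u' : 'rV_n, u *m A = u' *m (B - x *: A) & u' *m phi = 0.
  move/eqP; rewrite -sub_kermx => /submx_trans/(_ Kx)/submx_trans/(_ cJ).
  case/submxP => D ->; rewrite mulmxA; set y := D *m _.
  have : (y <= point_chains (J *m A) (J *m B) (Some x))%MS by apply: submxMl.
  rewrite /point_chains sub_chains at_point_mull off_point_mull => /andP[_].
  rewrite mulmxA => /submxP[z ->].
  split; first by rewrite -mulmxA Jphi mulmx0.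
  by exists (z *m J); rewrite ?mulmxA // -mulmxA Jphi mulmx0.
have vx : eval_mx x v *m (B - x *: A) = 0.
  by rewrite -eval_pencilX -map_mxM vN map_mx0.
have [vxphi [u vxA uphi]] := in_ker _ vx.
suff /in_ker[+ _] : (eval_mx x (map_mx (@deriv F) v) - u) *m (B - x *: A) = 0.
  by rewrite mulmxBl uphi subr0 => /eqP; apply/negP/vphi.
have := congr1 (fun M => map_mx (horner_eval x) (map_mx (@deriv F) M)) vN.
rewrite /= deriv_mulmx deriv_pencilX !raddf0 mulmxN map_mxB.
by rewrite !(map_mxM (horner_eval x)) eval_pencilX eval_polymx vxA -mulmxBl => ->.
Qed.

(** Outside the finite set consisting of infinity and of the roots [rs] of a generic
rank condition, either the members of the pencil have no kernel or
[cuts_generic] applies; on this finite set, let phi be nonzero on a chosen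
nonzero chain vector. *)
Lemma cutting_functional : (exists p, point_chains A B p != 0) ->
  exists phi,
    (exists p (v : 'rV_n), v *m at_point A B p = 0 /\ v *m phi != 0) /\
    forall p, point_chains A B p != 0 -> cuts phi p.
Proof.
move=> [p0 cp0].
pose ws rs := [seq nz_row (point_chains A B p) | p <- None :: map Some rs
   & point_chains A B p != 0].
have ws0 rs : 0 \notin ws rs.
  apply/mapP => -[p]; rewrite mem_filter => /andP[cp _] /esym/eqP.
  by rewrite nz_row_eq0 (negPf cp).
have wsP rs phi p : {in ws rs, forall w, w *m phi != 0} ->
    (if p is Some x then x \in rs else true) -> point_chains A B p != 0 ->
    nz_row (point_chains A B p) *m phi != 0.
  move=> wphi prs cp; apply/wphi/map_f; rewrite mem_filter cp inE.
  by move: prs; clear cp; case: p => //= x; apply: map_f.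
have [[g g0 gP]|[v vN vn0]] := generic_kernel A B.
  have [rs grs] := closed_field_poly_normal g.
  have [phi phiP] := generic_functional (ws0 rs).
  have cut p : point_chains A B p != 0 ->
    nz_row (point_chains A B p) *m phi != 0.
    move=> cp; apply: (wsP _ _ _ phiP _ cp); case: p cp => // x.
    apply: contraNT => xrs; rewrite -submx0.
    have : row_free (B - x *: A).
      apply: gP; apply: contra xrs; rewrite grs -[_ == 0]/(root _ x).
      by rewrite rootZ ?lead_coef_eq0 // root_prod_XsubC.
    rewrite -kermx_eq0 => /eqP <-; rewrite sub_kermx.
    have := submx_refl (point_chains A B (Some x)).
    by rewrite sub_chains => /andP[].
  exists phi; split; last by move=> p /cut/cuts_nz.
  exists p0, (nz_row (point_chains A B p0)); split; last exact: cut.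
  by have := nz_row_sub (point_chains A B p0); rewrite sub_chains => /andP[/eqP].
have [g g0 gP] := chains_generic A B.
have [rs grs] := closed_field_poly_normal g.
have [phi phiP phi1] := simple_root_functional (ws0 rs) vn0.
exists phi; split.
  have [x vx] : exists x, eval_mx x v *m phi != 0.
    apply/not_existsP => vphi.
    have vphi0 x : eval_mx x v *m phi = 0 by apply/eqP/negPn/negP/vphi.
    have /eqP[] := phi1 0 (vphi0 0).
    have {}vphi0 : v *m polymx phi = 0.
      apply: (eval_inj (oner_neq0 _)) => x _.
      by rewrite (map_mxM (horner_eval x)) eval_polymx vphi0 map_mx0.
    have := congr1 (fun M => map_mx (horner_eval 0) (map_mx (@deriv F) M)) vphi0.
    rewrite /= deriv_mulmx deriv_polymx mulmx0 addr0 (map_mxM (horner_eval 0)).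
    by rewrite eval_polymx !raddf0.
  exists (Some x), (eval_mx x v); split=> //=.
  by rewrite -eval_pencilX -map_mxM vN map_mx0.
move=> [x|] cp; last by apply/cuts_nz/(wsP _ _ _ phiP).
have [xrs|xrs] := boolP (x \in rs); first by apply/cuts_nz/(wsP _ _ _ phiP).
apply: (cuts_generic vN _ (phi1 x)); apply: gP.
apply: contra xrs; rewrite grs -[_ == 0]/(root _ x).
by rewrite rootZ ?lead_coef_eq0 // root_prod_XsubC.
Qed.

End Hyperplane.

(** Subtracting the projection along v onto the hyperplane leaves phi (x) (v A, v B),
which is simple because v A and v B are proportional when v is in the kernel of a
member of the pencil. *)
Lemma pencil_decomp_hyperplane (F : fieldType) n m (A B : 'M[F]_(n, m)) p
    (v : 'rV_n) (phi : 'cV_n) r : v *m at_point A B p = 0 -> v *m phi != 0 ->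
  let J := row_base (kermx phi) in
  pencil_decomp (J *m A) (J *m B) r -> pencil_decomp A B (r + 1).
Proof.
move=> vp vphi J JAB; pose c := (v *m phi) 0 0.
have vphiE : v *m phi = c%:M by rewrite [LHS]mx11_scalar.
have c0 : c != 0 by apply: contraNneq vphi; rewrite vphiE => ->; rewrite raddf0.
have /submxP[E EJ] : (1%:M - c^-1 *: (phi *m v) <= J)%MS.
  rewrite eq_row_base sub_kermx mulmxBl mul1mx -scalemxAl -mulmxA vphiE.
  by rewrite mul_mx_scalar scalerA mulVf // scale1r subrr.
have split1 k (M : 'M_(n, k)) : M = E *m (J *m M) + c^-1 *: (phi *m (v *m M)).
  by rewrite [E *m _]mulmxA -EJ mulmxBl mul1mx -scalemxAl mulmxA subrK.
have [a [b [a' [b' /(_ _ _ A B)[AE BE]]]]] := point_span p.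
have EJAB : pencil_decomp (E *m (J *m A)) (E *m (J *m B)) r.
  have [P [Q [al [be [-> ->]]]]] := JAB.
  by exists (E *m P), Q, al, be; rewrite !mulmxA.
have := pencil_decomp_add1 phi (v *m off_point A B p)
  (c^-1 * a) (c^-1 * b) EJAB.
rewrite -!scalerA !(scalemxAr _ phi).
have -> : a *: (v *m off_point A B p) = v *m A.
  by rewrite [in RHS]AE mulmxDr -!scalemxAr vp scaler0 addr0.
have -> : b *: (v *m off_point A B p) = v *m B.
  by rewrite [in RHS]BE mulmxDr -!scalemxAr vp scaler0 addr0.
by rewrite -!scalemxAr -!split1.
Qed.

(** Each hyperplane lowers the bound [D] by one and costs one simple tensor. *)
Theorem pencil_decomp_upper (F : numClosedFieldType) D n m (A B : 'M[F]_(n, m)) :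
  (forall p, (\rank (point_chains A B p) <= D)%N) -> pencil_decomp A B (m + D).
Proof.
elim: D n A B => [|D IH] n A B cD.
  rewrite addn0; apply: pencil_decomp_no_chain => p; apply/eqP.
  by rewrite -mxrank_eq0 -leqn0 cD.
have [AB0|AB1] := pselect (forall p, point_chains A B p = 0).
  by apply: pencil_decomp_pad (pencil_decomp_no_chain AB0) _; apply: leq_addr.
have [|phi [[p [v [vp vphi]]] cut]] := @cutting_functional _ _ _ A B.
  by apply/not_existsP => cN; apply: AB1 => p; apply/eqP/negPn/negP/cN.
rewrite addnS -addn1; apply: (pencil_decomp_hyperplane vp vphi).
set J := row_base _; apply: IH => q.
have Jphi : J *m phi = 0 by apply/sub_kermxP; rewrite eq_row_base.
have Jle : (point_chains (J *m A) (J *m B) q *m J <= point_chains A B q)%MS.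
  by rewrite /point_chains at_point_mull off_point_mull chains_restrict.
rewrite -(mxrankMfree _ (row_base_free (kermx phi))) -/J.
have [c0|/cut/(_ _ _ Jphi) cJ] := eqVneq (point_chains A B q) 0.
  by move: Jle; rewrite c0 submx0 => /eqP ->; rewrite mxrank0.
rewrite -ltnS; apply: leq_trans (cD q).
rewrite ltn_neqAle mxrankS // andbT; apply: contra cJ => /eqP rJ.
by rewrite -(mxrank_leqif_sup Jle).2 rJ.
Qed.

(** * Lower bound *)

(** Here [W] consists of chain vectors at N = P diag(a) Q, with W M = U N, and K is
the row kernel of Q, of dimension r - m. Write z for the projection onto the
coordinates where a vanishes. The map v |-> v P diag(a) sends W into the part of K
killed by z. On its kernel, with vM = uN, the vector v P diag(b) - u P diag(a) is
again in K, and z sends it to v P diag(b) z. If this vanishes, then v P is killed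
by diag(a) and diag(b), so v is killed by N and M, and v = 0. Hence
dim W <= dim (K :&: ker z) + dim (K z) = r - m. *)
Lemma pencil_decomp_lower (F : fieldType) n m k r (N M : 'M[F]_(n, m))
    (W : 'M_(k, n)) :
    row_free (row_mx N M) -> row_full (col_mx N M) -> row_free W ->
    W *m N = 0 -> (W *m M <= N)%MS ->
  pencil_decomp N M r -> (m + k <= r)%N.
Proof.
move=> NMfree NMfull Wfree WN /submxP[U WM] [P [Q [a [b [NE ME]]]]].
have Qr : \rank Q = m.
  apply/eqP; rewrite eqn_leq rank_leq_col -{1}(eqP NMfull).
  have -> : col_mx N M = col_mx (P *m diag_mx a) (P *m diag_mx b) *m Q.
    by rewrite mul_col_mx -NE -ME.
  exact: mxrankM_maxr.
pose K := kermx Q; pose z := diag_mx (\row_j (a 0 j == 0)%:R : 'rV[F]_r).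
pose X := W *m P *m diag_mx a; pose L := kermx X.
have mul_diag i (V : 'M_(i, r)) c i0 j :
  (V *m diag_mx c) i0 j = V i0 j * c 0 j by rewrite mul_mx_diag mxE.
have mul_z i (V : 'M_(i, r)) i0 j : (V *m z) i0 j = V i0 j * (a 0 j == 0)%:R.
  by rewrite mul_diag mxE.
have az : diag_mx a *m z = 0.
  apply/matrixP => i j; rewrite mul_z !mxE.
  have [->|_] := eqVneq i j; last by rewrite mul0r.
  by have [->|_] := eqVneq (a 0 j) 0; rewrite ?mul0rn ?mul0r ?mulr0.
have XK : (X <= K :&: kermx z)%MS.
  rewrite sub_capmx !sub_kermx /X -!mulmxA az !mulmx0 eqxx andbT.
  by rewrite (mulmxA P) -NE WN.
pose Z := W *m P *m diag_mx b *m z.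
have LZ0 : (L :&: kermx Z)%MS = 0.
  apply/eqP; rewrite -submx0; apply/rV_subP => v; rewrite sub_capmx !sub_kermx.
  move=> /andP[/eqP vX /eqP vZ].
  have va : v *m W *m P *m diag_mx a = 0 by rewrite -[RHS]vX /X !mulmxA.
  have vb : v *m W *m P *m diag_mx b = 0.
    apply/rowP => j; rewrite [RHS]mxE.
    have [aj|aj] := eqVneq (a 0 j) 0.
      have /rowP/(_ j) : v *m W *m P *m diag_mx b *m z = 0.
        by rewrite -[RHS]vZ /Z !mulmxA.
      by rewrite mul_z aj eqxx mulr1 [X in _ = X -> _]mxE.
    move/rowP/(_ j): va; rewrite !mul_diag [X in _ = X -> _]mxE => /eqP.
    by rewrite mulf_eq0 (negPf aj) orbF => /eqP ->; rewrite mul0r.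
  have : v *m W *m row_mx N M = 0.
    by rewrite mul_mx_row NE ME !mulmxA va vb !mul0mx row_mx0.
  move/eqP; rewrite mulmx_free_eq0 // mulmx_free_eq0 // => /eqP ->.
  exact: sub0mx.
have LZ : (L *m Z <= K *m z)%MS.
  have -> : L *m Z = (L *m (W *m P *m diag_mx b - U *m P *m diag_mx a)) *m z.
    by rewrite /Z mulmxBr mulmxBl -!mulmxA az !mulmx0 subr0.
  apply/submxMr; rewrite sub_kermx -mulmxA mulmxBl -!mulmxA.
  by rewrite (mulmxA P) -ME (mulmxA P) -NE WM subrr !mulmx0.
have rW : (\rank X + \rank L = k)%N.
  by rewrite mxrank_ker subnKC ?rank_leq_row.
have := mxrank_mul_ker L Z; rewrite LZ0 mxrank0 addn0 => rLZ.
have := mxrank_mul_ker K z; rewrite mxrank_ker Qr => rK.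
have := mxrankS XK; have := mxrankS LZ.
have : (m <= r)%N by rewrite -Qr rank_leq_row.
lia.
Qed.

(** * Kronecker product of a pencil with a matrix *)

Section Kronecker.
Variable F : fieldType.

Lemma tensmx1 n r : 1%:M *t 1%:M = 1%:M :> 'M[F]_(n * r).
Proof.
apply/matrixP => i j.
case: (mxtens_indexP i) => i0 i1; case: (mxtens_indexP j) => j0 j1.
rewrite tensmxE !mxE (can_eq (@mxtens_indexK _ _)) xpair_eqE.
by case: (i0 == j0); case: (i1 == j1); rewrite ?mulr1 ?mulr0.
Qed.

Lemma tensmxDl n m p q (A B : 'M[F]_(n, m)) (S : 'M_(p, q)) :
  (A + B) *t S = A *t S + B *t S.
Proof. by apply/matrixP => i j; rewrite !mxE mulrDl. Qed.

Lemma row_free_tensmx1 n m r (A : 'M[F]_(n, m)) :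
  row_free A -> row_free (A *t (1%:M : 'M_r)).
Proof.
move=> /row_freeP[B AB]; apply/row_freeP; exists (B *t 1%:M).
by rewrite tensmx_mul AB mul1mx tensmx1.
Qed.

Lemma row_free_row_tensmx1 n m r (A B : 'M[F]_(n, m)) :
  row_free (row_mx A B) -> row_free (row_mx (A *t (1%:M : 'M_r)) (B *t 1%:M)).
Proof.
move=> /row_freeP[C]; rewrite -[C]vsubmxK mul_row_col => AB; apply/row_freeP.
exists (col_mx (usubmx C *t 1%:M) (dsubmx C *t 1%:M)).
by rewrite mul_row_col !tensmx_mul mulmx1 -tensmxDl AB tensmx1.
Qed.

Lemma row_full_col_tensmx1 n m r (A B : 'M[F]_(n, m)) :
  row_full (col_mx A B) -> row_full (col_mx (A *t (1%:M : 'M_r)) (B *t 1%:M)).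
Proof.
move=> /row_fullP[C]; rewrite -[C]hsubmxK mul_row_col => AB; apply/row_fullP.
exists (row_mx (lsubmx C *t 1%:M) (rsubmx C *t 1%:M)).
by rewrite mul_row_col !tensmx_mul mulmx1 -tensmxDl AB tensmx1.
Qed.

(** Full-rank factorization, of the rows and then of the columns. Both outer factors
have one-sided inverses, so decompositions transfer in both directions. *)
Lemma concise_reduction n m (A B : 'M[F]_(n, m)) :
  exists n' m' (C : 'M_(n, n')) (A' B' : 'M_(n', m')) (H : 'M_(m', m)),
    [/\ row_full C, row_free H, row_free (row_mx A' B') &
      row_full (col_mx A' B') /\ (A = C *m A' *m H /\ B = C *m B' *m H)].
Proof.
pose C := col_base (row_mx A B); pose R := row_base (row_mx A B).
have AB : row_mx A B = row_mx (C *m lsubmx R) (C *m rsubmx R).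
  by rewrite -mul_mx_row hsubmxK mulmx_base.
have [AE BE] := eq_row_mx AB.
pose T := col_mx (lsubmx R) (rsubmx R).
pose G := col_base T; pose H := row_base T.
have [LE RE] : lsubmx R = usubmx G *m H /\ rsubmx R = dsubmx G *m H.
  by apply: eq_col_mx; rewrite -mul_col_mx vsubmxK mulmx_base.
exists (\rank (row_mx A B)), (\rank T), C, (usubmx G), (dsubmx G), H; split.
- exact: col_base_full.
- exact: row_base_free.
- have /row_freeP[Y RY] := row_base_free (row_mx A B); apply/row_freeP.
  exists (col_mx (H *m usubmx Y) (H *m dsubmx Y)).
  rewrite mul_row_col (mulmxA (usubmx G)) (mulmxA (dsubmx G)) -LE -RE.
  by rewrite -mul_row_col hsubmxK vsubmxK.
- by rewrite vsubmxK -!(mulmxA C) -LE -RE; split=> //; apply: col_base_full.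
Qed.

Lemma pencil_decomp_mul n m n' m' (A B : 'M[F]_(n, m)) (C : 'M_(n', n))
    (H : 'M_(m, m')) r :
  pencil_decomp A B r -> pencil_decomp (C *m A *m H) (C *m B *m H) r.
Proof.
move=> [P [Q [a [b [-> ->]]]]].
by exists (C *m P), (Q *m H), a, b; rewrite !mulmxA.
Qed.

Lemma pencil_decomp_point n m (A B : 'M[F]_(n, m)) p r :
  pencil_decomp A B r ->
  pencil_decomp (at_point A B p) (off_point A B p) r.
Proof.
move=> [P [Q [a [b [AE BE]]]]]; case: p => [x|]; last by exists P, Q, a, b.
exists P, Q, (b - x *: a), a; split=> //=; rewrite AE BE.
have -> : diag_mx (b - x *: a) = diag_mx b - x *: diag_mx a.
  by apply/matrixP => i j; rewrite !mxE mulrnBl mulrnAr.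
by rewrite mulmxBr mulmxBl -scalemxAr -scalemxAl.
Qed.

Lemma pencil_span_free n m (A B : 'M[F]_(n, m)) p : row_free (row_mx A B) ->
  row_free (row_mx (at_point A B p) (off_point A B p)).
Proof.
have [a [b [a' [b' /(_ _ _ A B)[AE BE]]]]] := point_span p.
rewrite -!kermx_eq0 -!submx0 => /(submx_trans _); apply.
have := submx_refl (kermx (row_mx (at_point A B p) (off_point A B p))).
rewrite !sub_kermx !mul_mx_row !row_mx_eq0 => /andP[/eqP Kat /eqP Koff].
set K := kermx _ in Kat Koff *.
have -> : K *m A = 0 by rewrite AE mulmxDr -!scalemxAr Kat Koff !scaler0 addr0.
by rewrite BE mulmxDr -!scalemxAr Kat Koff !scaler0 addr0 eqxx.
Qed.

Lemma pencil_span_full n m (A B : 'M[F]_(n, m)) p : row_full (col_mx A B) ->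
  row_full (col_mx (at_point A B p) (off_point A B p)).
Proof.
have [a [b [a' [b' /(_ _ _ A B)[AE BE]]]]] := point_span p.
move=> /row_fullP[C]; rewrite -[C]hsubmxK mul_row_col => CAB; apply/row_fullP.
exists (row_mx (a' *: lsubmx C + b' *: rsubmx C)
               (a *: lsubmx C + b *: rsubmx C)).
have CA : lsubmx C *m A =
    lsubmx C *m (a *: off_point A B p + a' *: at_point A B p).
  by rewrite -AE.
have CB : rsubmx C *m B =
    rsubmx C *m (b *: off_point A B p + b' *: at_point A B p).
  by rewrite -BE.
rewrite mul_row_col -CAB CA CB !mulmxDl !mulmxDr -!scalemxAl -!scalemxAr.
by rewrite addrC [RHS]addrACA.
Qed.

End Kronecker.

(** At a point where [point_chains] has its largest rank D, the upper bound m' + D for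
the concise core of the pencil, whose width is m', meets the lower bound for
rank S copies of it: the copies of the chain vectors are again chain vectors. *)
Theorem pencil_decomp_tens (F : numClosedFieldType) n m d e (A B : 'M[F]_(n, m))
    (S : 'M[F]_(d, e)) r :
  pencil_decomp (A *t S) (B *t S) r ->
  exists2 N, pencil_decomp A B N & (N * \rank S <= r)%N.
Proof.
have [n' [m' [C [A' [B' [H [Cfull Hfree ABfree [ABfull [-> ->]]]]]]]]] :=
  concise_reduction A B.
set I := 1%:M : 'M[F]_(\rank S).
move=> ABS; have {}ABS : pencil_decomp (A' *t I) (B' *t I) r.
  have [CL CLC] := row_fullP Cfull; have [HR HHR] := row_freeP Hfree.
  have [SL SLS] := row_fullP (col_base_full S).
  have [SR SRS] := row_freeP (row_base_free S).
  have SE : SL *m S *m SR = 1%:M.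
    transitivity (SL *m (col_base S *m row_base S) *m SR).
      by rewrite mulmx_base.
    by rewrite mulmxA SLS mul1mx.
  have core M : (CL *t SL) *m ((C *m M *m H) *t S) *m (HR *t SR) = M *t I.
    by rewrite !tensmx_mul SE !mulmxA CLC mul1mx -mulmxA HHR mulmx1.
  by have := pencil_decomp_mul (CL *t SL) (HR *t SR) ABS; rewrite !core.
pose P k := `[< exists p, \rank (point_chains A' B' p) = k >].
have Pex : exists k, P k.
  by exists (\rank (point_chains A' B' None)); apply/asboolP; exists None.
have Pub k : P k -> (k <= n')%N by move=> /asboolP[x <-]; apply: rank_leq_row.
case: (ex_maxnP Pex Pub) => D /asboolP[p pD] Dmax.
exists (m' + D)%N.
  apply/pencil_decomp_mul/pencil_decomp_upper => q.
  by apply: Dmax; apply/asboolP; exists q.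
pose W := row_base (point_chains A' B' p).
have := submx_refl W; rewrite {2}/W eq_row_base sub_chains => /andP[/eqP WN].
case/submxP => U WM.
have tens_at q : at_point (A' *t I) (B' *t I) q = at_point A' B' q *t I.
  case: q => //= x; apply/matrixP => i j; rewrite !mxE; ring.
have tens_off q : off_point (A' *t I) (B' *t I) q = off_point A' B' q *t I.
  by case: q.
rewrite mulnDl -pD; have := pencil_decomp_point p ABS; rewrite tens_at tens_off.
apply: (@pencil_decomp_lower _ _ _ _ _ _ _ (W *t I)).
- exact/row_free_row_tensmx1/pencil_span_free.
- exact/row_full_col_tensmx1/pencil_span_full.
- exact/row_free_tensmx1/row_base_free.
- by rewrite tensmx_mul WN tens0mx.
- by rewrite tensmx_mul WM -tensmx_mul submxMl.
Qed.

(** * Tensors and pencils *)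

Section TensorProducts.
Variables (F : fieldType) (K L : finType).

Lemma sum_of_simple_kronecker (T S : K -> finType) (t : tensor F T)
    (s : tensor F S) r :
  sum_of_simple (tensor_prod t s) r -> sum_of_simple (kronecker_prod t s) r.
Proof.
move=> [u ts]; exists (fun j k => [ffun p : prod_family T S k =>
  u j (inl k) p.1 * u j (inr k) p.2]).
apply/ffunP => J; rewrite !ffunE.
pose I : multi_index (sum_family T S) := [ffun k : K + K =>
  match k return sum_family T S k with
  | inl k => (J k).1 | inr k => (J k).2 end].
have := congr1 (fun f : tensor F _ => f I) ts; rewrite /= ffunE sum_ffunE.
have -> : finfun (fun k => I (inl k)) = finfun (fun k => (J k).1).
  by apply/ffunP => k; rewrite !ffunE.
have -> : finfun (fun k => I (inr k)) = finfun (fun k => (J k).2).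
  by apply/ffunP => k; rewrite !ffunE.
move=> ->; rewrite sum_ffunE; apply: eq_bigr => j _.
rewrite !ffunE big_sumType /=.
under [RHS]eq_bigr => k _ do rewrite ffunE.
by rewrite big_split; congr (_ * _); apply: eq_bigr => k _; rewrite ffunE.
Qed.

Lemma sum_of_simple_prod (T : K -> finType) (S : L -> finType) (t : tensor F T)
    (s : tensor F S) a b :
  sum_of_simple t a -> sum_of_simple s b ->
  sum_of_simple (tensor_prod t s) (a * b).
Proof.
move=> [u ->] [v ->].
exists (fun j k => match k return {ffun sum_family T S k -> F} with
  | inl k => u (mxtens_unindex j).1 k | inr l => v (mxtens_unindex j).2 l end).
apply/ffunP => I; rewrite !ffunE !sum_ffunE mulr_sum; apply: eq_bigr => j _.
rewrite !ffunE big_sumType /=; congr (_ * _); apply: eq_bigr => k _.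
  by rewrite ffunE.
by rewrite ffunE.
Qed.

End TensorProducts.

Notation mode0 := (@Ordinal 3 0 isT).
Notation mode1 := (@Ordinal 3 1 isT).
Notation mode2 := (@Ordinal 3 2 isT).

Lemma forall_mode (P : 'I_3 -> Prop) :
  P mode0 -> P mode1 -> P mode2 -> forall k, P k.
Proof.
by move=> P0 P1 P2 [[|[|[|//]]] h]; rewrite (bool_irrelevance h isT).
Qed.

Lemma mode_exhausted k : mode0 <> k -> mode1 <> k -> mode2 <> k -> False.
Proof. by move: k; apply: forall_mode. Qed.

(** The types of the three values are those of the family at explicit ordinals,
whence the transports. *)
Definition fam3 (T : 'I_3 -> Type) (x : T mode0) (y : T mode1) (z : T mode2) k :
    T k :=
  match mode0 =P k, mode1 =P k, mode2 =P k with
  | ReflectT e, _, _ => ecast k (T k) e x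
  | _, ReflectT e, _ => ecast k (T k) e y
  | _, _, ReflectT e => ecast k (T k) e z
  | ReflectF n0, ReflectF n1, ReflectF n2 =>
    match mode_exhausted n0 n1 n2 with end
  end.

Arguments fam3 T x y z k : clear implicits.

Section ThreeModes.

Lemma fam3E (T : 'I_3 -> Type) (x : T mode0) (y : T mode1) (z : T mode2) :
  (fam3 T x y z mode0 = x) * (fam3 T x y z mode1 = y) *
  (fam3 T x y z mode2 = z).
Proof.
rewrite /fam3; do 3?split.
- by case: eqP => // e; rewrite (eq_axiomK e).
- by case: eqP => //; case: eqP => // e; rewrite (eq_axiomK e).
- by case: eqP => //; case: eqP => //; case: eqP => // e; rewrite (eq_axiomK e).
Qed.

Variable F : fieldType.

Lemma prod_mode (f : 'I_3 -> F) :
  \prod_k f k = f mode0 * f mode1 * f mode2.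
Proof.
rewrite !big_ord_recl big_ord0 mulr1 mulrA.
by congr (_ * _ * _); congr f; apply: val_inj.
Qed.

Variable T : 'I_3 -> finType.

Definition idx3 (x : T mode0) (y : T mode1) (z : T mode2) : multi_index T :=
  [ffun k : 'I_3 => fam3 (fun k => T k) x y z k].

Lemma idx3_eta (I : multi_index T) : I = idx3 (I mode0) (I mode1) (I mode2).
Proof.
by apply/ffunP; apply: forall_mode; rewrite ffunE fam3E.
Qed.

Lemma sum_of_simple3P (t : tensor F T) r :
  sum_of_simple t r <->
  exists (f : 'I_r -> T mode0 -> F) (g : 'I_r -> T mode1 -> F)
      (h : 'I_r -> T mode2 -> F),
    forall x y z, t (idx3 x y z) = \sum_j f j x * g j y * h j z.
Proof.
split=> [[u ->]|[f [g [h tE]]]].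
  exists (fun j => u j mode0), (fun j => u j mode1), (fun j => u j mode2).
  move=> x y z; rewrite sum_ffunE; apply: eq_bigr => j _.
  by rewrite ffunE prod_mode !ffunE !fam3E.
exists (fun j => fam3 (fun k => {ffun T k -> F})
  (finfun (f j)) (finfun (g j)) (finfun (h j))).
apply/ffunP => I; rewrite [I in LHS]idx3_eta tE sum_ffunE.
apply: eq_bigr => j _; by rewrite ffunE prod_mode !fam3E !ffunE.
Qed.

End ThreeModes.

Section Slices.
Variable F : fieldType.

Definition slice a n m (t : tensor3 F a n m) (x : 'I_a) : 'M[F]_(n, m) :=
  \matrix_(i, j) t (@idx3 (dim3 a n m) x i j).

Lemma sum_of_simple_pencil n m (t : tensor3 F 2 n m) r :
  pencil_decomp (slice t 0) (slice t 1) r -> sum_of_simple t r.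
Proof.
move=> [P [Q [a [b [tA tB]]]]]; apply/sum_of_simple3P.
exists (fun j (x : 'I_2) => if x == 0 then a 0 j else b 0 j).
exists (fun j i => P i j), (fun j i => Q j i) => x i l.
have slE : t (idx3 x i l) = slice t x i l by rewrite mxE.
transitivity (slice t x i l); first exact: slE.
have mE c : (P *m diag_mx c *m Q) i l = \sum_j c 0 j * P i j * Q j l.
  by rewrite mxE; apply: eq_bigr => j _; rewrite mul_mx_diag mxE (mulrC (P i j)).
have [->|x0] := eqVneq x 0; first by rewrite tA mE.
have -> : x = 1 by apply: val_inj; case: x x0 {slE} => -[|[|]].
by rewrite tB mE.
Qed.

Lemma sum_of_simple_slice d (s : tensor3 F 1 d d) :
  sum_of_simple s (\rank (slice s 0)).
Proof.
apply/sum_of_simple3P; pose S := slice s 0.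
exists (fun _ _ => 1), (fun j i => col_base S i j), (fun j i => row_base S j i).
move=> x i l; transitivity (S i l); first by rewrite mxE (ord1 x).
rewrite -{1}(mulmx_base S) mxE; apply: eq_bigr => j _.
by rewrite mul1r.
Qed.

Lemma kronecker_idx3 (T S : 'I_3 -> finType) (t : tensor F T) (s : tensor F S)
    x y z x' y' z' :
  kronecker_prod t s (@idx3 (prod_family T S) (x, x') (y, y') (z, z')) =
  t (idx3 x y z) * s (idx3 x' y' z').
Proof.
rewrite ffunE; congr (t _ * s _); apply/ffunP; apply: forall_mode;
  by rewrite !ffunE !fam3E.
Qed.

Lemma kronecker_pencil d n m (t : tensor3 F 2 n m) (s : tensor3 F 1 d d) r :
  sum_of_simple (kronecker_prod t s) r ->
  pencil_decomp (slice t 0 *t slice s 0) (slice t 1 *t slice s 0) r.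
Proof.
move=> /sum_of_simple3P[f [g [h tsE]]].
pose P := \matrix_(i < n * d, j < r) g j (mxtens_unindex i).
pose Q := \matrix_(j < r, i < m * d) h j (mxtens_unindex i).
pose c (x : 'I_2) := \row_(j < r) f j (x, 0 : 'I_1).
suff E x : slice t x *t slice s 0 = P *m diag_mx (c x) *m Q.
  by exists P, Q, (c 0), (c 1).
apply/matrixP => i l; rewrite !mxE.
rewrite -(kronecker_idx3 t s).
transitivity (\sum_j f j (x, 0 : 'I_1) * g j (mxtens_unindex i) *
  h j (mxtens_unindex l)).
  exact: tsE.
apply: eq_bigr => j _; rewrite mul_mx_diag !mxE; congr (_ * _); exact: mulrC.
Qed.

End Slices.

Theorem proposition22 (R : realType) (d n m : nat)
    (d_ge1 : (1 <= d)%N) (n_ge1 : (1 <= n)%N) (m_ge1 : (1 <= m)%N)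
    (s : tensor3 (complex R) 1 d d)
    (t : tensor3 (complex R) 2 n m) :
  tensor_rank (kronecker_prod t s) = tensor_rank (tensor_prod t s) /\
  tensor_rank (tensor_prod t s) = (tensor_rank t * tensor_rank s)%N.
Proof.
have I3 : (0 < #|'I_3|)%N by rewrite card_ord.
have I33 : (0 < #|{: 'I_3 + 'I_3}|)%N by rewrite card_sum card_ord.
have [tr tmin] := tensor_rankP t I3.
have [sr smin] := tensor_rankP s I3.
have [kr kmin] := tensor_rankP (kronecker_prod t s) I3.
have [pr pmin] := tensor_rankP (tensor_prod t s) I33.
have kp := kmin _ (sum_of_simple_kronecker pr).
have pts := pmin _ (sum_of_simple_prod tr sr).
have [N tN Nk] := pencil_decomp_tens (kronecker_pencil kr).
have tsk : (tensor_rank t * tensor_rank s <= tensor_rank (kronecker_prod t s))%N.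
  apply: leq_trans Nk; apply: leq_mul; first exact/tmin/sum_of_simple_pencil.
  exact/smin/sum_of_simple_slice.
by split; apply/eqP; rewrite eqn_leq;
  rewrite ?kp ?pts /= ?(leq_trans pts tsk) ?(leq_trans tsk kp).
Qed.
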